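(* No Queen-Bee network with average degree strictly greater than $2$ is (asymptotically) optimal among all rooted graphs. Precisely: for every real $\alpha>2$ there is $\delta>0$ such that every Queen-Bee network $G$ (with any number of non-root vertices) of average degree $\alpha$ satisfies $B(G)\ge b(\alpha)+\delta$.
   Context: A graph means a finite graph, possibly with multiple (parallel) edges; each edge is a unit resistor, and $R_{xy}$ denotes effective resistance ($R_{xx}=0$; $R_{xy}=\infty$ if $x,y$ lie in different components). A rooted graph is a graph with a designated root vertex $\rho$. A Queen-Bee network is a rooted graph in which every non-root vertex is joined to the root by at least one edge (multiple edges are allowed). For a rooted graph with $n\ge1$ non-root vertices, $B(G)=\frac1n\sum_{x\in V(G)}R_{\rho x}$, and its average degree is $2e(G)/n$, where $e(G)$ is the number of edges. Define $b_n(\alpha)=\min\{B(G):G\text{ rooted},\ |V(G)|=n+1,\ e(G)\le\alpha n/2\}$ and $b(\alpha)=\lim_{n\to\infty}b_n(\alpha)$ (the limit exists for $\alpha\ge2$). *)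

(* Defs.v *)
From HB Require Import structures.
From mathcomp Require Import all_boot all_order all_algebra.
From mathcomp Require Import all_classical all_reals all_analysis.

Set Implicit Arguments.
Unset Strict Implicit.
Unset Printing Implicit Defensive.

Import Order.TTheory GRing.Theory Num.Theory.
Import numFieldNormedType.Exports.

Local Open Scope classical_set_scope.
Local Open Scope ring_scope.

(* Parallel edges are distinct elements of [edge] with the same [ends];
   there are no loops. *)
Record rooted_graph : Type := RootedGraph {
  vertex : finType;
  edge : finType;
  ends : edge -> {set vertex};
  card_ends : forall e, #|ends e| = 2%N;
  root : vertex }.

Definition num_edges (G : rooted_graph) : nat := #|edge G|.

Definition num_nonroot (G : rooted_graph) : nat :=
  #|[pred x : vertex G | x != root G]|.

Definition adj (G : rooted_graph) : rel (vertex G) :=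
  fun x y => [exists e : edge G, ends e == [set x; y]%SET].

(* Ohm's and Kirchhoff's laws for unit resistors: under the potential [v],
   unit current enters the network at [x] and leaves it at [y]. The inner sum
   is v z - v w for the other end w of e, since the term w = z vanishes. *)
Definition unit_current (R : realType) (G : rooted_graph) (x y : vertex G)
    (v : vertex G -> R) : Prop :=
  forall z, \sum_(e : edge G | z \in ends e) \sum_(w in ends e) (v z - v w)
            = (z == x)%:R - (z == y)%:R.

(* When x and y lie in the same component, such potentials exist and all give
   the same difference v x - v y, so the default value 0 is never used. *)
Definition eff_res (R : realType) (G : rooted_graph) (x y : vertex G) : \bar R :=
  if connect (@adj G) x y then
    (xget 0 [set r : R | exists v, unit_current x y v /\ r = v x - v y])%:E
  else +oo%E.

Definition mean_res (R : realType) (G : rooted_graph) : \bar R :=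
  (((num_nonroot G)%:R^-1)%:E *
     \sum_(x : vertex G) eff_res R (root G) x)%E.

Definition average_degree (R : realType) (G : rooted_graph) : R :=
  2 * (num_edges G)%:R / (num_nonroot G)%:R.

Definition queen_bee (G : rooted_graph) : Prop :=
  forall x : vertex G, x != root G ->
    exists e : edge G, ends e = [set root G; x]%SET.

(* The infimum is a minimum: up to isomorphism there are finitely many rooted
   graphs with n + 1 vertices and a bounded number of edges. *)
Definition b_fin (R : realType) (alpha : R) (n : nat) : \bar R :=
  ereal_inf [set r | exists G : rooted_graph,
    [/\ #|vertex G| = n.+1,
        (num_edges G)%:R <= alpha * n%:R / 2 &
        r = mean_res R G]].

Definition b_lim (R : realType) (alpha : R) : \bar R :=
  lim (b_fin alpha n @[n --> \oo]).

(* Main.v *)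
(* Write R_x for the resistance between x and the root, n for the number of
   non-root vertices, r = alpha/2 - 1 for the number of edges per vertex beyond
   one root edge each, and g for the Green function of the network grounded at
   the root, so that R_x = g x x. In a queen-bee network the rows of g sum to at
   most 1.

   If a positive proportion of the vertices have R_x < 1/2 - eps, choose among
   them a set X of size at least a constant times n on which g is nearly
   diagonal. Take two copies of the network and replace the root edge of the
   first copy of each x in X by an edge joining the two copies of x: the number
   of edges is unchanged and the mean resistance drops by a constant.

   Otherwise a discharging argument over the edges bounds the mean of 1 - R_x
   by min(2r/3, 3r/8 + 1/6, 1/2), up to a small error. This bound is beaten,
   for every r > 0, by gluing at the root copies of three explicit networks: a
   single edge, two adjacent hubs joined to the root by two and by three paths
   of length 2, and a path on 8 vertices all joined to the root.

   Gluing copies of one network at the root gives good networks only along a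
   subsequence of vertex numbers. This bounds [b_lim] when the limit exists;
   otherwise [lim] takes the junk value 0, which is below every mean resistance. *)

Require Import Defs.
From HB Require Import structures.
From mathcomp Require Import all_boot all_order all_algebra.
From mathcomp Require Import all_classical all_reals all_analysis.
From mathcomp Require Import ring lra.

Set Implicit Arguments.
Unset Strict Implicit.
Unset Printing Implicit Defensive.

Import Order.TTheory GRing.Theory Num.Theory.
Import numFieldNormedType.Exports.

Local Open Scope ring_scope.


(** * Networks, Dirichlet forms and gluing at the root *)

(* A network is a finite type [T] of non-root vertices and a list of edges over
   [option T], where [None] is the root; potentials vanish at the root. *)
Definition pot (R : realType) (T : Type) (w : T -> R) (o : option T) : R :=
  if o is Some x then w x else 0.

Definition dirichlet (R : realType) (T : Type) (s : seq (option T * option T))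
    (u w : T -> R) : R :=
  \sum_(e <- s) (pot u e.1 - pot u e.2) * (pot w e.1 - pot w e.2).

(* The variational bound on [b x] is Thomson's principle: the supremum over [w]
   of [2 w x - energy w] is the effective resistance between [x] and the root. *)
Definition achievable (R : realType) (n m : nat) (t : R) : Prop :=
  exists (T : finType) (s : seq (option T * option T)) (b : T -> R),
    [/\ #|T| = n, size s = m, all (fun e => e.1 != e.2) s, \sum_x b x = t &
        forall x w, 2 * w x - dirichlet s w w <= b x].

Section Dirichlet.
Variables (R : realType) (T : Type).
Implicit Types (s : seq (option T * option T)) (u v w : T -> R).

Lemma pot_lin (a : R) u w o :
  pot (fun x => a * u x + w x) o = a * pot u o + pot w o.
Proof. by case: o => [x|] /=; rewrite ?mulr0 ?addr0. Qed.

Lemma dirichletC s u w : dirichlet s u w = dirichlet s w u.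
Proof. by apply: eq_bigr => e _; rewrite mulrC. Qed.

Lemma dirichlet_linl s a u v w :
  dirichlet s (fun x => a * u x + v x) w
  = a * dirichlet s u w + dirichlet s v w.
Proof.
rewrite /dirichlet mulr_sumr -big_split /=.
by apply: eq_bigr => e _; rewrite !pot_lin; ring.
Qed.

Lemma dirichlet_ge0 s w : 0 <= dirichlet s w w.
Proof. by apply: sumr_ge0 => e _; rewrite -expr2 sqr_ge0. Qed.

Lemma dirichlet_cat s1 s2 u w :
  dirichlet (s1 ++ s2) u w = dirichlet s1 u w + dirichlet s2 u w.
Proof. by rewrite /dirichlet big_cat. Qed.

(** Completing the square: the energy of [w - u] is nonnegative. *)
Lemma dirichlet_le_green s u v w x :
  (forall w', dirichlet s u w' = w' x) -> 2 * w x - dirichlet s w w <= u x.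
Proof.
move=> hu; have := dirichlet_ge0 s (fun y => -1 * u y + w y).
rewrite dirichlet_linl !(dirichletC _ _ (fun y => _ + _)) !dirichlet_linl.
by rewrite (dirichletC _ w u) !hu; lra.
Qed.

End Dirichlet.

Lemma dirichlet_map (R : realType) (T U : Type) (f : T -> U)
    (s : seq (option T * option T)) (u w : U -> R) :
  dirichlet [seq (omap f e.1, omap f e.2) | e <- s] u w
  = dirichlet s (u \o f) (w \o f).
Proof.
have potE (v : U -> R) o : pot v (omap f o) = pot (v \o f) o by case: o.
by rewrite /dirichlet big_map; apply: eq_bigr => e _ /=; rewrite !potE.
Qed.

Lemma loopless_map (A B : eqType) (f : A -> B) (s : seq (option A * option A)) :
  injective f -> all (fun e => e.1 != e.2) s ->
  all (fun e => e.1 != e.2) [seq (omap f e.1, omap f e.2) | e <- s].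
Proof.
move=> inj_f; rewrite all_map; apply: sub_all => -[[a|] [b|]] //=.
by apply: contraNN => /eqP[/inj_f->].
Qed.

(** Gluing at the root: the part not containing [x] only adds nonnegative energy, so every
    variational bound survives. *)
Lemma achievable_add (R : realType) n1 m1 (t1 : R) n2 m2 t2 :
  achievable n1 m1 t1 -> achievable n2 m2 t2 ->
  achievable (n1 + n2)%N (m1 + m2)%N (t1 + t2).
Proof.
move=> [T1 [s1 [b1 [<- <- nl1 <- le1]]]] [T2 [s2 [b2 [<- <- nl2 <- le2]]]].
exists (T1 + T2)%type.
exists ([seq (omap inl e.1, omap inl e.2) | e <- s1] ++
        [seq (omap inr e.1, omap inr e.2) | e <- s2]).
exists (fun x => match x with inl y => b1 y | inr y => b2 y end); split.
- by rewrite card_sum.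
- by rewrite size_cat !size_map.
- by rewrite all_cat !loopless_map // => x y [].
- by rewrite big_sumType.
- move=> x w; rewrite dirichlet_cat !dirichlet_map.
  have := dirichlet_ge0 s1 (w \o inl); have := dirichlet_ge0 s2 (w \o inr).
  case: x => x.
    by have := le1 x (w \o inl) => /=; lra.
  by have := le2 x (w \o inr) => /=; lra.
Qed.

Lemma achievable_mul (R : realType) n m (t : R) k :
  achievable n m t -> achievable (k * n)%N (k * m)%N (k%:R * t).
Proof.
move=> h; elim: k => [|k IH].
  rewrite !mul0n mul0r; exists 'I_0, [::], (fun=> 0); split=> //.
  - by rewrite card_ord.
  - by rewrite big_ord0.
  - by case.
by rewrite !mulSn -add1n natrD mulrDl mul1r; apply: achievable_add.
Qed.

(** * The three explicit networks *)

Section Gadgets.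
Variable R : realType.

Lemma achievable_green (n : nat) (s : seq (option 'I_n * option 'I_n))
    (g : 'I_n -> 'I_n -> R) :
  all (fun e => e.1 != e.2) s -> (forall x w, dirichlet s (g x) w = w x) ->
  achievable n (size s) (\sum_x g x x).
Proof.
move=> nls hg; exists 'I_n, s, (fun x => g x x); split=> //.
  by rewrite card_ord.
by move=> x w; apply: dirichlet_le_green.
Qed.

Lemma achievable_leaf : achievable 1 1 (1 : R).
Proof.
have := @achievable_green 1 [:: (None, Some ord0)] (fun _ _ => 1).
rewrite big_ord1; apply=> // x w.
by rewrite /dirichlet big_cons big_nil /= !ord1; ring.
Qed.

(* [M / c] is the Green function of the network with inner edges [l] and one
   root edge at each vertex of [ks]. *)
Lemma achievable_table (n : nat) (l : seq (nat * nat)) (ks : seq nat)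
    (M : seq (seq nat)) (c t : nat) :
  (0 < c)%N -> all (fun k => k < n.+1)%N ks ->
  all (fun p => [&& p.1 < n.+1, p.2 < n.+1 & p.1 != p.2])%N l ->
  (forall i (w : nat -> R), (i < n.+1)%N ->
     \sum_(p <- l) ((nth 0 (nth [::] M i) p.1)%:R - (nth 0 (nth [::] M i) p.2)%:R)
        * (w p.1 - w p.2)
     + \sum_(k <- ks) (nth 0 (nth [::] M i) k)%:R * w k = c%:R * w i) ->
  (\sum_(i < n.+1) nth 0 (nth [::] M i) i = t)%N ->
  achievable n.+1 (size l + size ks) (t%:R / c%:R : R).
Proof.
move=> c0 hks hl hM <-; pose v k : option 'I_n.+1 := Some (inord k).
have cn0 : c%:R != 0 :> R by rewrite pnatr_eq0 -lt0n.
have := @achievable_green n.+1 ([seq (v p.1, v p.2) | p <- l] ++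
    [seq (v k, None) | k <- ks])
  (fun i j => (nth 0 (nth [::] M i) j)%:R / c%:R).
rewrite size_cat !size_map natr_sum mulr_suml; apply.
  rewrite all_cat !all_map (sub_all _ hl)/= ?all_predT //
    => -[a b] /and3P[/= ha hb].
  by apply: contraNN => /eqP[/(congr1 val)]; rewrite /= !inordK// => ->.
move=> x w; apply: (mulfI cn0).
rewrite -[in RHS](inord_val x) -(hM x (fun k => w (inord k)))//.
rewrite dirichlet_cat /dirichlet !big_map mulrDr !mulr_sumr; congr (_ + _).
  apply: eq_big_seq => p /(allP hl) /and3P[ha hb _] /=.
  by rewrite !inordK//; field.
apply: eq_big_seq => k /(allP hks) hk /=.
by rewrite inordK// !subr0; field.
Qed.

(** The hubs are [0] and [1]; the midpoints of their paths to the root are [2], [3] and [4], [5],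
    [6]. There are 4 extra edges on 7 vertices. *)
Lemma achievable_hubs : achievable 7 11 (138 / 32 : R).
Proof.
pose M : seq (seq nat) :=
  [:: [:: 20; 8; 10; 10; 4; 4; 4]; [:: 8; 16; 4; 4; 8; 8; 8];
      [:: 10; 4; 21; 5; 2; 2; 2]; [:: 10; 4; 5; 21; 2; 2; 2];
      [:: 4; 8; 2; 2; 20; 4; 4]; [:: 4; 8; 2; 2; 4; 20; 4];
      [:: 4; 8; 2; 2; 4; 4; 20]]%N.
apply: (@achievable_table 6
  [:: (0, 1); (0, 2); (0, 3); (1, 4); (1, 5); (1, 6)] [:: 2; 3; 4; 5; 6] M
  _ 138) => // [i w|]; last by rewrite !big_ord_recr big_ord0.
by do 7?[case: i => [_|i]; first by rewrite !big_cons !big_nil /=; ring].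
Qed.

(** The grounded Laplacian has determinant [987], the Fibonacci number F(16), and for [i <= j] the
    table entry is F(2i+1) F(15-2j). The mean is just below [1/2], with 7 extra edges on 8
    vertices. *)
Lemma achievable_path : achievable 8 15 (3926 / 987 : R).
Proof.
pose M : seq (seq nat) :=
  [:: [:: 610; 233; 89; 34; 13; 5; 2; 1];
      [:: 233; 466; 178; 68; 26; 10; 4; 2];
      [:: 89; 178; 445; 170; 65; 25; 10; 5];
      [:: 34; 68; 170; 442; 169; 65; 26; 13];
      [:: 13; 26; 65; 169; 442; 170; 68; 34];
      [:: 5; 10; 25; 65; 170; 445; 178; 89];
      [:: 2; 4; 10; 26; 68; 178; 466; 233];
      [:: 1; 2; 5; 13; 34; 89; 233; 610]]%N.
apply: (@achievable_table 7
  [:: (0, 1); (1, 2); (2, 3); (3, 4); (4, 5); (5, 6); (6, 7)]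
  [:: 0; 1; 2; 3; 4; 5; 6; 7] M _ 3926) => // [i w|].
  by do 8?[case: i => [_|i]; first by rewrite !big_cons !big_nil /=; ring].
by rewrite !big_ord_recr big_ord0.
Qed.
End Gadgets.


(** * The quadratic form of a queen-bee network *)

(* A queen-bee network is encoded by its non-root vertices [T] and the list [s]
   of the edges left after removing one root edge per vertex. *)
Definition qform (R : realType) (T : finType) (s : seq (option T * option T))
    (u w : T -> R) : R :=
  \sum_x u x * w x + dirichlet s u w.

Definition point_mass (R : realType) (T : eqType) (x y : T) : R := (y == x)%:R.

Definition extra_degree (T : eqType) (s : seq (option T * option T)) (x : T) : nat :=
  \sum_(e <- s) ((e.1 == Some x) + (e.2 == Some x)).

Section QueenBee.
Variables (R : realType) (T : finType) (s : seq (option T * option T)).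
Implicit Types (u v w : T -> R) (x y z : T).
Local Notation Q := (qform s).
Local Notation ind := (@point_mass R T).
Local Notation deg := (extra_degree s).

Lemma qformC u w : Q u w = Q w u.
Proof.
rewrite /qform dirichletC; congr (_ + _).
by apply: eq_bigr => x _; rewrite mulrC.
Qed.

Lemma qform_linl a u v w : Q (fun x => a * u x + v x) w = a * Q u w + Q v w.
Proof.
rewrite /qform dirichlet_linl mulrDr addrACA; congr (_ + _).
by rewrite mulr_sumr -big_split; apply: eq_bigr => x _ /=; ring.
Qed.

Lemma qform_linr a u v w : Q w (fun x => a * u x + v x) = a * Q w u + Q w v.
Proof. by rewrite qformC qform_linl !(qformC w). Qed.

Lemma qform_scale a u : Q (fun x => a * u x) (fun x => a * u x) = a ^+ 2 * Q u u.
Proof.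
have potM o : pot (fun x => a * u x) o = a * pot u o.
  by case: o => //=; rewrite mulr0.
rewrite /qform /dirichlet mulrDr !mulr_sumr; congr (_ + _).
  by apply: eq_bigr => x _; ring.
by apply: eq_bigr => e _; rewrite !potM; ring.
Qed.

Lemma qform_oppl u w : Q (fun x => - u x) w = - Q u w.
Proof.
have potN o : pot (fun x => - u x) o = - pot u o by case: o => //=; rewrite oppr0.
rewrite /qform /dirichlet opprD -!sumrN; congr (_ + _).
  by apply: eq_bigr => x _; ring.
by apply: eq_bigr => e _; rewrite !potN; ring.
Qed.

Lemma qform_suml (I : finType) (P : pred I) (a : I -> R) (u : I -> T -> R) w :
  Q (fun x => \sum_(i | P i) a i * u i x) w = \sum_(i | P i) a i * Q (u i) w.
Proof.
have pot_sum o : pot (fun x => \sum_(i | P i) a i * u i x) o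
    = \sum_(i | P i) a i * pot (u i) o.
  by case: o => //=; rewrite big1 // => i _; rewrite mulr0.
under [RHS]eq_bigr do rewrite /qform mulrDr /dirichlet !mulr_sumr.
rewrite big_split /= /qform /dirichlet [X in _ = _ + X]exchange_big.
rewrite [X in _ = X + _]exchange_big /=; congr (_ + _).
  by apply: eq_bigr => x _; rewrite mulr_suml; apply: eq_bigr => i _; rewrite mulrA.
apply: eq_bigr => e _; rewrite !pot_sum -sumrB mulr_suml.
by apply: eq_bigr => i _; ring.
Qed.

Lemma qform_sumr (I : finType) (P : pred I) (a : I -> R) (u : I -> T -> R) w :
  Q w (fun x => \sum_(i | P i) a i * u i x) = \sum_(i | P i) a i * Q w (u i).
Proof. by rewrite qformC qform_suml; apply: eq_bigr => i _; rewrite qformC. Qed.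

Lemma sum_sqr_le_qform w : \sum_x w x ^+ 2 <= Q w w.
Proof.
by rewrite /qform lerDl dirichlet_ge0.
Qed.

Lemma qform_ge0 w : 0 <= Q w w.
Proof.
by apply: le_trans (sum_sqr_le_qform w); apply: sumr_ge0 => x _; rewrite sqr_ge0.
Qed.

Lemma qform_eq0 w : Q w w <= 0 -> w =1 (fun=> 0).
Proof.
move=> Qw x; apply/eqP; rewrite -sqrf_eq0 eq_le sqr_ge0 andbT.
apply: le_trans (le_trans (sum_sqr_le_qform w) Qw).
by rewrite (bigD1 x)//= lerDl sumr_ge0// => y _; rewrite sqr_ge0.
Qed.

Lemma sum_ind w x : w x = \sum_y w y * ind y x.
Proof.
rewrite (bigD1 x)//= /point_mass eqxx mulr1 big1 ?addr0// => y.
by rewrite eq_sym => /negbTE->; rewrite mulr0.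
Qed.

Lemma qform_indr u w : Q u w = \sum_y w y * Q u (ind y).
Proof.
by rewrite -qform_sumr; congr (Q u _); apply/funext => x; exact: sum_ind.
Qed.

(** The form is positive definite, so its Gram matrix on point masses is invertible; [g x] is a row
    of the inverse. *)
Lemma green_exists : exists g : T -> T -> R, forall x w, Q (g x) w = w x.
Proof.
pose A : 'M[R]_#|T| := \matrix_(i, j) Q (ind (enum_val i)) (ind (enum_val j)).
pose f (v : 'rV[R]_#|T|) x := v 0 (enum_rank x).
have mulA (v : 'rV[R]_#|T|) y : (v *m A) 0 (enum_rank y) = Q (f v) (ind y).
  have -> : f v = fun x => \sum_i v 0 i * ind (enum_val i) x.
    apply/funext => x; rewrite (sum_ind (f v)).
    rewrite (reindex_onto enum_rank enum_val) /=; last first.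
      by move=> i _; rewrite enum_valK.
    by apply: eq_big => [y'|y' _]; rewrite enum_rankK ?eqxx.
  rewrite qform_suml mxE; apply: eq_bigr => i _.
  by rewrite mxE enum_rankK.
have unitA : A \in unitmx.
  rewrite -row_free_unit; apply: inj_row_free => v vA0.
  have /qform_eq0 f0 : Q (f v) (f v) <= 0.
    by rewrite qform_indr big1 // => y _; rewrite -mulA vA0 mxE mulr0.
  by apply/rowP => i; rewrite mxE -(enum_valK i); exact: f0.
exists (fun x => f (delta_mx 0 (enum_rank x) *m invmx A)) => x w.
rewrite qform_indr [RHS]sum_ind; apply: eq_bigr => y _.
rewrite -mulA mulmxKV// mxE eqxx /=.
by rewrite /point_mass (inj_eq enum_rank_inj) eq_sym.
Qed.

End QueenBee.


(** * Estimates for the Green function *)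

Section Green.
Variables (R : realType) (T : finType) (s : seq (option T * option T)).
Variable g : T -> T -> R.
Hypothesis greenP : forall x w, qform s (g x) w = w x.
Hypothesis loopless : all (fun e => e.1 != e.2) s.
Implicit Types (u v w : T -> R) (x y z : T).
Local Notation Q := (qform s).
Local Notation ind := (@point_mass R T).
Local Notation deg := (extra_degree s).

Lemma green_sym x y : g x y = g y x.
Proof. by rewrite -(greenP y (g x)) qformC greenP. Qed.

(* Minimum principle: testing against the negative part of [g x]. *)
Lemma green_ge0 x y : 0 <= g x y.
Proof.
pose w z : R := Num.max (- g x z) 0.
have w_ge0 z : 0 <= w z by rewrite le_max lexx orbT.
have potw o : pot w o = Num.max (- pot (g x) o) 0.
  by case: o => //=; rewrite oppr0 maxxx.
have neg_part (a b : R) : (a - b) * (Num.max (- a) 0 - Num.max (- b) 0)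
    <= - ((Num.max (- a) 0 - Num.max (- b) 0)
          * (Num.max (- a) 0 - Num.max (- b) 0)).
  by case: (lerP (- a) 0) => ?; case: (lerP (- b) 0) => ?; nra.
have : Q (g x) w <= - Q w w.
  rewrite /qform /dirichlet opprD -!sumrN; apply: lerD.
    by apply: ler_sum => z _; have := neg_part (g x z) 0;
      rewrite oppr0 maxxx oppr0 !addr0.
  by apply: ler_sum => e _; rewrite !potw neg_part.
rewrite greenP => Qww.
have /(_ y) : w =1 (fun=> 0).
  by apply: (@qform_eq0 _ _ s); rewrite -oppr_ge0; exact: le_trans (w_ge0 x) Qww.
by move=> wy0; rewrite -oppr_le0 -[leRHS]wy0 le_max lexx.
Qed.

(** Tested against the constant 1, only edges of [s] at the root contribute to the Dirichlet part,
    each by some [g x y >= 0]. *)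
Lemma green_row_sum x : \sum_y g x y <= 1.
Proof.
rewrite -(greenP x (fun=> 1)) /qform.
under [X in _ <= X + _]eq_bigr do rewrite mulr1.
rewrite lerDl; apply: sumr_ge0 => -[[a|] [b|]] _ /=.
all: by rewrite ?subrr ?mulr0 ?subr0 ?sub0r ?mulrNN ?mulr1 ?green_ge0.
Qed.

Lemma energy_le_green x w : 2 * w x - Q w w <= g x x.
Proof.
have := qform_ge0 s (fun y => -1 * g x y + w y).
rewrite qform_linl !qform_linr !greenP qformC greenP; lra.
Qed.

Lemma pot_point_mass x o : pot (ind x) o = (o == Some x)%:R.
Proof. by case: o. Qed.

Lemma qform_point_mass u x :
  Q u (ind x) = u x + \sum_(e <- s) (pot u e.1 - pot u e.2)
                        * ((e.1 == Some x)%:R - (e.2 == Some x)%:R).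
Proof.
congr (_ + _); last by apply: eq_bigr => e _; rewrite !pot_point_mass.
by rewrite [RHS](sum_ind u); apply: eq_bigr => y _; rewrite /point_mass eq_sym.
Qed.

Lemma qform_point_mass_diag x : Q (ind x) (ind x) = 1 + (deg x)%:R.
Proof.
rewrite qform_point_mass /point_mass eqxx natr_sum; congr (_ + _).
apply: eq_big_seq => e /(allP loopless) ne; rewrite !pot_point_mass natrD.
case: (e.1 =P Some x) ne => [->|_]; case: (e.2 =P Some x) => [->|_];
by rewrite ?eqxx// => _ /=; ring.
Qed.

(** Thomson's bound at a multiple of the point mass. Leaving [a] free keeps the bound linear in the
    degree, so it can be summed over vertices. *)
Lemma green_diag_lb x (a : R) : 2 * a - a ^+ 2 * (1 + (deg x)%:R) <= g x x.
Proof.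
have := energy_le_green x (fun y => a * ind x y).
by rewrite qform_scale qform_point_mass_diag /point_mass eqxx mulr1.
Qed.

Lemma sum_extra_degree (c : T -> R) :
  \sum_x (deg x)%:R * c x = \sum_(e <- s) (pot c e.1 + pot c e.2).
Proof.
have potE o : pot c o = \sum_x (o == Some x)%:R * c x.
  case: o => [y|] /=; last by rewrite big1 // => x _; rewrite mul0r.
  by rewrite [LHS](sum_ind c); apply: eq_bigr => x _; rewrite mulrC.
under eq_bigr do rewrite natr_sum mulr_suml.
rewrite exchange_big; apply: eq_bigr => e _.
by rewrite !potE -big_split; apply: eq_bigr => x _; rewrite natrD mulrDl.
Qed.

Lemma sum_degree_le : \sum_x (1 + (deg x)%:R) <= #|T|%:R + 2 * (size s)%:R :> R.
Proof.
rewrite big_split /= sumr_const lerD2l.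
under eq_bigr do rewrite -[_%:R]mulr1.
rewrite sum_extra_degree; apply: (@le_trans _ _ (\sum_(e <- s) 2)).
  by apply: ler_sum => -[[?|] [?|]] _ /=; lra.
by rewrite big_const_seq count_predT iter_addr addr0 mulr_natr.
Qed.

Lemma green_isolated x : deg x = 0 -> g x x = 1.
Proof.
move=> d0; have := greenP x (ind x).
rewrite qform_point_mass /point_mass eqxx big1_seq ?addr0// => e /= es.
move/eqP: d0; rewrite sum_nat_seq_eq0 => /allP/(_ e es).
by rewrite /= addn_eq0 !eqb0 => /andP[/negbTE-> /negbTE->]; rewrite subrr mulr0.
Qed.

Lemma qform_pendant u x y : deg x = 1 ->
  ((Some x, Some y) \in s) || ((Some y, Some x) \in s) ->
  Q u (ind x) = 2 * u x - u y.
Proof.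
move=> d1 xys; rewrite qform_point_mass.
pose e0 := if (Some x, Some y) \in s then (Some x, Some y) else (Some y, Some x).
have e0s : e0 \in s by rewrite /e0; case: ifP xys.
have xy : x != y.
  by have := allP loopless _ e0s; rewrite /e0; case: ifP; rewrite //= eq_sym.
have yx : (Some y == Some x) = false by rewrite eq_sym; apply/negbTE.
move: d1; rewrite /extra_degree (perm_big _ (perm_to_rem e0s)) big_cons /=.
have -> : ((e0.1 == Some x) + (e0.2 == Some x) = 1)%N.
  by rewrite /e0; case: ifP => _ /=; rewrite eqxx yx.
move=> [/eqP]; rewrite sum_nat_seq_eq0 => /allP rest0.
rewrite (perm_big _ (perm_to_rem e0s)) big_cons /= [X in _ + (_ + X)]big1_seq.
  by rewrite /e0; case: ifP => _ /=; rewrite eqxx yx /=; ring.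
move=> e /= /rest0; rewrite /= addn_eq0 !eqb0 => /andP[/negbTE-> /negbTE->].
by rewrite subrr mulr0.
Qed.
End Green.


(** * Discharging over the extra edges *)

Section Charging.
Variables (R : realType) (T : finType) (s : seq (option T * option T)).
Variable g : T -> T -> R.
Hypothesis greenP : forall x w, qform s (g x) w = w x.
Hypothesis loopless : all (fun e => e.1 != e.2) s.
Implicit Types (x y z : T).
Local Notation deg := (extra_degree s).

Lemma extra_degree_gt0 e x : e \in s -> (e.1 == Some x) || (e.2 == Some x) ->
  (0 < deg x)%N.
Proof.
move=> es; rewrite lt0n; apply: contraL.
rewrite sum_nat_seq_eq0 => /allP/(_ e es) /=.
by rewrite addn_eq0 !eqb0 negb_or.
Qed.

(** Testing [g x] and [g y] against the point mass at [x] gives [2 * g x x - g x y = 1] and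
    [2 * g y x = g y y]. *)
Lemma green_pendant x y : deg x = 1%N ->
  ((Some x, Some y) \in s) || ((Some y, Some x) \in s) ->
  g x x = 1 / 2 + g y y / 4.
Proof.
move=> dx xys; have xy : x != y.
  by case/orP: xys => /(allP loopless); rewrite //= eq_sym.
have := greenP x (point_mass R x); have := greenP y (point_mass R x).
rewrite !(qform_pendant loopless _ dx xys) /point_mass eqxx eq_sym (negbTE xy).
by rewrite (green_sym greenP y x) /=; lra.
Qed.

(* Every vertex splits its demand evenly among the extra edges at it; no edge
   is charged more than [lam]. *)
Lemma charging_bound (lam mu : R) :
  0 <= mu <= 1 / 2 -> 1 / 2 <= lam + mu -> 1 / 3 <= lam / 2 + mu ->
  5 / 4 <= 2 * lam + 3 * mu ->
  \sum_x (1 - mu - g x x - 2 * Num.max (1 / 2 - g x x) 0) <= lam * (size s)%:R.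
Proof.
move=> /andP[mu0 mu1] c1 c2 c3.
(* The demand [h] peaks at resistance [1/2] with value [1/2 - mu]. Hence [c1] settles edges to the
   root and edges between two vertices of extra degree at least 2. *)
pose h (r : R) := 1 - mu - r - 2 * Num.max (1 / 2 - r) 0.
pose hp (r : R) := Num.max (h r) 0.
pose c x := hp (g x x) / (deg x)%:R.
have hp0 r : 0 <= hp r by rewrite le_max lexx orbT.
have hp1 r : hp r <= 1 / 2 - mu.
  rewrite ge_max; apply/andP; split; last by lra.
  by rewrite /h; case: (lerP (1 / 2 - r) 0); lra.
have c_ge0 x : 0 <= c x by rewrite divr_ge0.
have c_le1 x : (0 < deg x)%N -> c x <= hp (g x x).
  by move=> d0; rewrite ler_pdivrMr ?ltr0n// ler_peMr// ler1n.
have c_le2 x : (1 < deg x)%N -> c x <= hp (g x x) / 2.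
  by move=> d1; rewrite ler_wpM2l// lef_pV2 ?posrE ?ltr0n
      ?(ltnW d1)// (ler_nat R 2).
have pendant x y : ((Some x, Some y) \in s) || ((Some y, Some x) \in s) ->
    deg x = 1%N -> (0 < deg y)%N -> c x + c y <= lam.
  move=> xys dx dy; have Rx := green_pendant dx xys.
  have hpE r : 1 / 2 <= r -> hp r = Num.max (1 - mu - r) 0.
    by move=> hr; rewrite /hp /h; case: (lerP (1 / 2 - r) 0) => ?;
      congr Num.max; lra.
  have Ry0 := green_ge0 greenP y y;
  have {}cx : c x <= hp (g x x) by apply: c_le1; rewrite dx.
  move: cx; rewrite hpE; last by lra.
  have [dy1|dy2] := leqP (deg y) 1.
    (* Two vertices pendant on each other both have resistance [2/3]; this is the case of [c2]. *)
    have dyE : deg y = 1%N by apply/eqP; rewrite eqn_leq dy1.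
    have Ry : g y y = 1 / 2 + g x x / 4 by apply: green_pendant; rewrite // orbC.
    have := c_le1 y dy; rewrite hpE; last by lra.
    by case: (lerP (1 - mu - g x x) 0); case: (lerP (1 - mu - g y y) 0); lra.
  (* When both demands are positive, the bound on the two charges is largest at [g y y = 1/2], where
     it is [5/8 - 3 * mu / 2]; hence [c3]. *)
  have := c_le2 y dy2; rewrite /hp /h.
  by case: (lerP (1 - mu - g x x) 0); case: (lerP (1 / 2 - g y y) 0) => ?;
     case: (lerP (1 - mu - g y y - _) 0); lra.
have edge x y : (Some x, Some y) \in s -> c x + c y <= lam.
  move=> es.
  have dx : (0 < deg x)%N by apply: (extra_degree_gt0 es); rewrite eqxx.
  have dy : (0 < deg y)%N by apply: (extra_degree_gt0 es); rewrite eqxx orbT.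
  have [dx1|dx2] := leqP (deg x) 1.
    by apply: pendant => //; [rewrite es | apply/eqP; rewrite eqn_leq dx1].
  have [dy1|dy2] := leqP (deg y) 1.
    rewrite addrC; apply: pendant => //; first by rewrite es orbT.
    by apply/eqP; rewrite eqn_leq dy1.
  by have := c_le2 x dx2; have := c_le2 y dy2; have := hp1 (g x x);
     have := hp1 (g y y); lra.
apply: (@le_trans _ _ (\sum_x (deg x)%:R * c x)).
  apply: ler_sum => x _; have [d0|d0] := posnP (deg x).
    rewrite (green_isolated greenP d0) d0 mul0r.
    by case: (lerP (1 / 2 - 1) 0); lra.
  by rewrite /c [leRHS]mulrC divfK ?pnatr_eq0 -?lt0n// /hp le_max lexx.
rewrite sum_extra_degree.
have -> : lam * (size s)%:R = \sum_(e <- s) lam.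
  by rewrite big_const_seq count_predT iter_addr addr0 mulr_natr.
rewrite big_seq [leRHS]big_seq; apply: ler_sum => -[[x|] [y|]] es /=.
- exact: edge.
- have dx : (0 < deg x)%N by apply: (extra_degree_gt0 es); rewrite eqxx.
  by have := c_le1 x dx; have := hp1 (g x x); lra.
- have dy : (0 < deg y)%N by apply: (extra_degree_gt0 es); rewrite eqxx orbT.
  by have := c_le1 y dy; have := hp1 (g y y); lra.
- lra.
Qed.

End Charging.


(** * Rewiring two copies of a queen-bee network *)

Definition rewire (T : finType) (s : seq (option T * option T)) (X : {set T}) :
    seq (option (T + T) * option (T + T)) :=
  [seq (if x \in X then Some (inr x) else None, Some (inl x)) | x <- enum T] ++
  [seq (None, Some (inr x)) | x <- enum T] ++
  [seq (omap inl e.1, omap inl e.2) | e <- s] ++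
  [seq (omap inr e.1, omap inr e.2) | e <- s].

Section Rewiring.
Variables (R : realType) (T : finType) (s : seq (option T * option T)).
Variable g : T -> T -> R.
Hypothesis greenP : forall x w, qform s (g x) w = w x.
Hypothesis loopless : all (fun e => e.1 != e.2) s.
Implicit Types (x y z : T) (X : {set T}) (w : T -> R).
Local Notation Q := (qform s).

(* [X] maximizes a quadratic functional over all subsets: that no element can
   be removed gives the first property, that none can be added the second. *)
Lemma spread_set_exists (th : R) : 0 <= th ->
  exists X, (forall x, x \in X -> \sum_(z in X) g x z <= th) /\
    \sum_x Num.max (th - g x x) 0 <= (1 + th) * #|X|%:R.
Proof.
move=> th0.
pose F X := \sum_(x in X) (th - g x x / 2)
  - (\sum_(x in X) \sum_(z in X) g x z) / 2.
have FU1 x X : x \notin X ->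
    F (x |: X)%SET = F X + th - g x x - \sum_(z in X) g x z.
  move=> xX; rewrite /F !big_setU1//=.
  have -> : \sum_(i in X) \sum_(z in (x |: X)%SET) g i z
      = \sum_(z in X) g x z + \sum_(i in X) \sum_(z in X) g i z.
    rewrite -big_split; apply: eq_bigr => i _.
    by rewrite big_setU1//= (green_sym greenP).
  by field.
case: (@arg_maxP _ _ _ (finset.set0 : {set T}) predT F isT) => X _ maxX.
have row x : x \in X -> \sum_(z in X) g x z <= th.
  move=> xX; have FX := FU1 x (X :\ x)%SET.
  rewrite finset.setD1K// finset.setD11 in FX.
  by have := maxX (X :\ x)%SET isT;
    rewrite FX// [X in _ -> X <= _](big_setD1 x)//=; lra.
exists X; split=> //.
have out x : x \notin X -> Num.max (th - g x x) 0 <= \sum_(z in X) g x z.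
  move=> xX; rewrite ge_max; apply/andP; split; last first.
    by apply: sumr_ge0 => z _; apply: (green_ge0 greenP).
  by have := maxX (x |: X)%SET isT; rewrite FU1//=; lra.
(* Outside [X], exchanging the sums and bounding row sums by 1 yields at most [#|X|]; inside, each
   term is at most [th]. *)
rewrite (bigID (mem X)) /= addrC mulrDl mul1r; apply: lerD.
  apply: (@le_trans _ _ (\sum_(x | x \notin X) \sum_(z in X) g x z)).
    by apply: ler_sum => x; apply: out.
  rewrite exchange_big /= -sum1_card natr_sum; apply: ler_sum => z _.
  apply: le_trans (green_row_sum greenP z); rewrite [leRHS](bigID (mem X)) /=.
  rewrite -[leLHS]add0r lerD//.
    by apply: sumr_ge0 => y _; apply: (green_ge0 greenP).
  by apply: ler_sum => y _; rewrite (green_sym greenP).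
rewrite -sum1_card natr_sum mulr_sumr; apply: ler_sum => x _.
by rewrite mulr1 ge_max th0 andbT lerBlDr lerDl (green_ge0 greenP).
Qed.

(** Schur's test bounds the norm of [g] restricted to [X] by [k^-1]; duality, in the form of a
    nonnegative energy for [w - k * u], turns this into a lower bound on [Q]. *)
Lemma spread_set_coercive X (k : R) : 0 < k ->
  (forall x, x \in X -> \sum_(z in X) g x z <= k^-1) ->
  forall w, k * \sum_(x in X) w x ^+ 2 <= Q w w.
Proof.
move=> k0 row w; set N := \sum_(x in X) w x ^+ 2.
pose u y := \sum_(x in X) w x * g x y.
have Qu v : Q u v = \sum_(x in X) w x * v x.
  by rewrite qform_suml; apply: eq_bigr => x _; rewrite greenP.
have QuN : Q u w = N by rewrite Qu; apply: eq_bigr => x _; rewrite expr2.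
have Quu : k * Q u u <= N.
  rewrite -ler_pdivlMl// Qu.
  apply: (@le_trans _ _
    (\sum_(x in X) \sum_(z in X) g x z * ((w x ^+ 2 + w z ^+ 2) / 2))).
    apply: ler_sum => x _; rewrite mulr_sumr; apply: ler_sum => z _.
    have := green_ge0 greenP x z; rewrite (green_sym greenP z x).
    by have := sqr_ge0 (w x - w z); nra.
  have -> : \sum_(x in X) \sum_(z in X) g x z * ((w x ^+ 2 + w z ^+ 2) / 2)
     = \sum_(x in X) \sum_(z in X) g x z * w x ^+ 2.
    have E : \sum_(x in X) \sum_(z in X) g x z * w z ^+ 2
        = \sum_(x in X) \sum_(z in X) g x z * w x ^+ 2.
      rewrite exchange_big; apply: eq_bigr => x _; apply: eq_bigr => z _.
      by rewrite (green_sym greenP).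
    transitivity ((\sum_(x in X) \sum_(z in X) g x z * w x ^+ 2) / 2
      + (\sum_(x in X) \sum_(z in X) g x z * w z ^+ 2) / 2); last first.
      by rewrite E; field.
    rewrite !mulr_suml -big_split; apply: eq_bigr => x _ /=.
    by rewrite !mulr_suml -big_split; apply: eq_bigr => z _ /=; field.
  rewrite mulr_sumr; apply: ler_sum => x xX.
  by rewrite -mulr_suml ler_wpM2r ?sqr_ge0 ?row.
have := qform_ge0 s (fun y => - k * u y + w y).
rewrite qform_linl !qform_linr (qformC _ w u) QuN.
have : k * (k * Q u u) <= k * N by rewrite ler_pM2l.
nra.
Qed.

(** Redirecting the root edge at [x] replaces the energy [w1 x ^+ 2] by [(w1 x - w2 x) ^+ 2]. *)
Lemma dirichlet_rewire X (w : T + T -> R) :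
  let w1 := w \o inl in let w2 := w \o inr in
  dirichlet (rewire s X) w w
  = Q w1 w1 + Q w2 w2 + \sum_(x in X) (w2 x ^+ 2 - 2 * w1 x * w2 x).
Proof.
move=> w1 w2; rewrite !dirichlet_cat !dirichlet_map.
have -> : dirichlet [seq (if x \in X then Some (inr x) else None, Some (inl x))
                      | x <- enum T] w w
    = \sum_x w1 x * w1 x + \sum_(x in X) (w2 x ^+ 2 - 2 * w1 x * w2 x).
  rewrite /dirichlet big_map big_enum [X in _ = _ + X]big_mkcond -big_split.
  by apply: eq_bigr => x _; rewrite /w1 /w2 /=; case: ifP => _ /=; ring.
have -> : dirichlet [seq (None, Some (inr x)) | x <- enum T] w w
    = \sum_x w2 x * w2 x.
  rewrite /dirichlet big_map big_enum.
  by apply: eq_bigr => x _; rewrite /w2 /=; ring.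
by rewrite /qform -/w1 -/w2; ring.
Qed.

(** Coercivity reduces each bound to a quadratic in two variables per [x] in [X], with leading form
    [k a^2 + (k + 1) b^2 - 2 a b] of determinant [D]. The first copy loses [k / D], the second gains
    [(k^2 - k) / D], so the balance is favourable exactly for [k > 2]; hence the threshold [1/2] on
    resistances. *)
Lemma achievable_rewire X (k : R) : 1 <= k ->
  (forall w, k * \sum_(x in X) w x ^+ 2 <= Q w w) ->
  achievable (2 * #|T|) (2 * (#|T| + size s))
    (2 * (\sum_x g x x) - (k ^+ 2 - 2 * k) / (k ^+ 2 + k - 1) *
                            \sum_(x in X) \sum_z g x z ^+ 2).
Proof.
move=> k1 coer; set D := k ^+ 2 + k - 1.
have D0 : 0 < D by rewrite /D; nra.
pose V z := \sum_(x in X) g z x ^+ 2.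
exists (T + T)%type, (rewire s X), (fun o => match o with
  | inl z => g z z + k / D * V z
  | inr z => g z z - (k ^+ 2 - k) / D * V z end); split.
- by rewrite card_sum mul2n addnn.
- rewrite !size_cat (size_map _ (enum T)) (size_map _ (enum T)) !(size_map _ s).
  by rewrite cardE mulnDr !mul2n -!addnn addnA.
- rewrite !all_cat; apply/and4P; split.
  + by rewrite all_map; apply/allP => x _ /=; case: ifP.
  + by rewrite all_map; apply/allP.
  + by apply: loopless_map => // x y [].
  + by apply: loopless_map => // x y [].
- rewrite big_sumType /= big_split sumrB -!mulr_sumr /=.
  have -> : \sum_z V z = \sum_(x in X) \sum_z g x z ^+ 2.
    rewrite exchange_big; apply: eq_bigr => x _; apply: eq_bigr => z _.
    by rewrite (green_sym greenP).
  by field; rewrite gt_eqF.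
- move=> z w; rewrite dirichlet_rewire; set w1 := w \o inl; set w2 := w \o inr.
  have Qshift y v : k * \sum_(x in X) (v x - g y x) ^+ 2 <= Q v v - 2 * v y + g y y.
    have := coer (fun x => -1 * g y x + v x).
    rewrite qform_linl !qform_linr !greenP qformC greenP.
    have -> : \sum_(x in X) (-1 * g y x + v x) ^+ 2
        = \sum_(x in X) (v x - g y x) ^+ 2.
      by apply: eq_bigr => x _; congr (_ ^+ 2); ring.
    by move=> h; apply: le_trans h _; lra.
  case: z => z /=.
  + have : 0 <= \sum_(x in X) (k * (w1 x - g z x) ^+ 2 + k * w2 x ^+ 2
        + (w2 x ^+ 2 - 2 * w1 x * w2 x) + k / D * g z x ^+ 2).
      apply: sumr_ge0 => x _; set a := w1 x; set b := w2 x; set v := g z x.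
      have -> : k * (a - v) ^+ 2 + k * b ^+ 2 + (b ^+ 2 - 2 * a * b)
           + k / D * v ^+ 2
        = k * (a - v - b / k) ^+ 2 + (D / k) * (b - k * v / D) ^+ 2.
        by rewrite /D; field; rewrite -/D !gt_eqF//; lra.
      by rewrite addr_ge0// mulr_ge0 ?sqr_ge0 ?divr_ge0//; lra.
    rewrite !big_split /= -!mulr_sumr.
    have := Qshift z w1; have := coer w2; rewrite /V /w1 /=.
    lra.
  + have : 0 <= \sum_(x in X) (k * w1 x ^+ 2 + k * (w2 x - g z x) ^+ 2
        + (w2 x ^+ 2 - 2 * w1 x * w2 x) - (k ^+ 2 - k) / D * g z x ^+ 2).
      apply: sumr_ge0 => x _; set a := w1 x; set b := w2 x; set v := g z x.
      have -> : k * a ^+ 2 + k * (b - v) ^+ 2 + (b ^+ 2 - 2 * a * b)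
           - (k ^+ 2 - k) / D * v ^+ 2
        = k * (a - b / k) ^+ 2 + (D / k) * (b - k ^+ 2 * v / D) ^+ 2.
        by rewrite /D; field; rewrite -/D !gt_eqF//; lra.
      by rewrite addr_ge0// mulr_ge0 ?sqr_ge0 ?divr_ge0//; lra.
    rewrite sumrB !big_split /= -!mulr_sumr.
    have := Qshift z w2; have := coer w1; rewrite /V /w2 /=.
    lra.
Qed.

End Rewiring.


(** * From electrical laws on graphs to variational bounds *)

Section GraphEnergy.
Variables (R : realType) (G : rooted_graph).
Implicit Types (x y z : vertex G) (v phi : vertex G -> R) (e : edge G).

Definition edge_form e v phi : R :=
  \sum_(z in ends e) phi z * \sum_(w in ends e) (v z - v w).

Lemma edge_formE e v phi x y : x != y -> ends e = [set x; y]%SET ->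
  edge_form e v phi = (v x - v y) * (phi x - phi y).
Proof.
move=> xy ee; rewrite /edge_form ee !big_setU1 ?big_set1 ?inE//=.
by rewrite !big_setU1 ?big_set1 ?inE//=; ring.
Qed.

(** The weak form of Kirchhoff's law: exchange the sums over vertices and edges; conversely, test
    against point masses. *)
Lemma unit_currentP x y v :
  unit_current x y v <->
  forall phi, \sum_e edge_form e v phi = phi x - phi y.
Proof.
have swap phi : \sum_e edge_form e v phi = \sum_z phi z *
    \sum_(e : edge G | z \in ends e) \sum_(w in ends e) (v z - v w).
  rewrite /edge_form (exchange_big_dep predT) //=; apply: eq_bigr => z _.
  by rewrite mulr_sumr.
have pick (a : vertex G) phi : \sum_z phi z * (z == a)%:R = phi a.
  by rewrite (bigD1 a)//= eqxx mulr1 big1 ?addr0// => z /negbTE->; rewrite mulr0.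
split=> [cur phi|test z].
  rewrite swap -(pick x phi) -(pick y phi) -sumrB.
  by apply: eq_bigr => z _; rewrite cur mulrBr.
have := test (fun z' => (z' == z)%:R); rewrite swap.
under eq_bigr do rewrite mulrC.
by rewrite pick (eq_sym x) (eq_sym y).
Qed.

End GraphEnergy.

Lemma adj_sym (G : rooted_graph) : symmetric (@adj G).
Proof. by move=> x y; apply: eq_existsb => e; rewrite finset.setUC. Qed.

Lemma eff_res_refl (R : realType) (G : rooted_graph) (x : vertex G) :
  eff_res R x x = 0%E.
Proof.
rewrite /eff_res connect0; congr (_%:E).
by case: xgetP => [_ _ [v [_ ->]]|//]; rewrite subrr.
Qed.

Section Realization.
Variables (R : realType) (T : finType) (s : seq (option T * option T)).
Hypothesis loopless : all (fun e => e.1 != e.2) s.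

Definition network_ends (i : 'I_(size s)) : {set option T} :=
  let e := tnth (in_tuple s) i in [set e.1; e.2]%SET.

Lemma card_network_ends i : #|network_ends i| = 2%N.
Proof. by rewrite cards2 (allP loopless) ?mem_tnth. Qed.

Definition network_graph : rooted_graph :=
  RootedGraph card_network_ends None.

Lemma adj_network_graph e : e \in s -> @adj network_graph e.1 e.2.
Proof.
move=> /(@tnthP _ _ (in_tuple s))[i ->].
by apply/existsP; exists i; rewrite /= /network_ends.
Qed.

(** Otherwise a potential constant off the component of the root has zero energy and too large a
    value at [x]. *)
Lemma connect_of_bounded x (b : R) :
  (forall w, 2 * w x - dirichlet s w w <= b) ->
  connect (@adj network_graph) None (Some x).
Proof.
move=> bounded; apply/negPn/negP => nconn.
pose c := connect (@adj network_graph) None.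
pose w y : R := if c (Some y) then 0 else `|b| + 1.
have potw o : pot w o = if c o then 0 else `|b| + 1.
  by case: o => //=; rewrite /c connect0.
have cE e : e \in s -> c e.1 = c e.2.
  move=> es; have := adj_network_graph es => a12.
  by apply/idP/idP => /connect_trans; apply; apply: connect1; rewrite // adj_sym.
have := bounded w; rewrite /dirichlet big1_seq ?subr0; last first.
  by move=> e es; rewrite !potw (cE e es) subrr mul0r.
rewrite /w /c (negbTE nconn).
by have := ler_norm b; have := normr_ge0 b; lra.
Qed.

Lemma eff_res_network_le x (b : R) :
  (forall w, 2 * w x - dirichlet s w w <= b) ->
  (eff_res R (Defs.root network_graph) (Some x) <= b%:E)%E.
Proof.
move=> bounded; rewrite /eff_res (connect_of_bounded bounded) lee_fin.
case: xgetP => [_ _ [v [/unit_currentP cur ->]]|_].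
  (* The voltage drop [w] has energy [w x], so its variational value is the resistance itself. *)
  pose w y := v None - v (Some y).
  have potw o : pot w o = v None - v o by case: o => //=; rewrite subrr.
  have : dirichlet s w w = w x.
    rewrite -[RHS](cur v) /dirichlet big_tnth; apply: eq_bigr => i _.
    have ne := allP loopless _ (mem_tnth i (in_tuple s)).
    rewrite !potw (@edge_formE R network_graph i v v _ _ ne erefl).
    by ring.
  by have := bounded w; rewrite /w; lra.
(* For the default value 0 the zero potential shows [0 <= b]. *)
have := bounded (fun=> 0).
have -> : dirichlet s (fun=> 0 : R) (fun=> 0) = 0.
  by rewrite /dirichlet big1// => -[[?|] [?|]] _ /=; ring.
by lra.
Qed.

End Realization.

Lemma b_fin_le (R : realType) (alpha : R) n m (t : R) :
  achievable n m t -> m%:R <= alpha * n%:R / 2 ->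
  (b_fin alpha n <= (n%:R^-1 * t)%:E)%E.
Proof.
move=> [T [s [b [nT ms nls <- bounded]]]] mle.
have nE : num_nonroot (network_graph nls) = n.
  rewrite /num_nonroot (eq_card (_ : _ =i predC1 (None : option T))) //.
  by rewrite cardC1 card_option nT.
apply: ge_ereal_inf; exists (mean_res R (network_graph nls)).
  exists (network_graph nls); split=> //; first by rewrite /= card_option nT.
  by rewrite /num_edges card_ord ms.
rewrite /mean_res nE EFinM lee_wpmul2l ?lee_fin ?invr_ge0//.
have -> : \sum_x b x = \sum_(o : option T) pot b o.
  rewrite (bigD1 None)//= add0r.
  rewrite (eq_bigl (mem [set Some x | x in T]%SET)).
    by rewrite big_imset//= => x y _ _ [].
  move=> [x|] /=; last by apply/esym/negbTE/imsetP => -[].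
  by rewrite mem_imset// => y z [].
rewrite -sumEFin; apply: lee_sum => -[x|] _ /=; first exact: eff_res_network_le.
by rewrite eff_res_refl.
Qed.

Lemma achievable_ge0 (R : realType) n m (t : R) : achievable n m t -> 0 <= t.
Proof.
move=> [T [s [b [_ _ _ <- bounded]]]]; apply: sumr_ge0 => x _.
have := bounded x (fun=> 0).
rewrite /dirichlet big1 => [|[[?|] [?|]] _ /=]; [|by ring|by ring|by ring|by ring].
by rewrite mulr0 subr0.
Qed.

Lemma b_lim_le (R : realType) (alpha : R) n m (t q : R) : (0 < n)%N ->
  achievable n m t -> m%:R <= alpha * n%:R / 2 -> t <= q * n%:R ->
  (b_lim alpha <= q%:E)%E.
Proof.
move=> n0 ach mle tq; apply: (@le_trans _ _ (n%:R^-1 * t)%:E); last first.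
  by rewrite lee_fin mulrC ler_pdivrMr ?ltr0n.
have t0 := achievable_ge0 ach; rewrite /b_lim.
case: (pselect (cvg (b_fin alpha k @[k --> \oo])%classic))
  => [cvb|/dvgP ->]; last first.
  by rewrite lee_fin mulr_ge0 ?invr_ge0.
have sub : ((fun k => k.+1 * n)%N @ \oo --> \oo)%classic.
  move=> P [N _ NP]; exists N => // k /= Nk; apply: NP => /=.
  by rewrite (leq_trans Nk)// (leq_trans (leqnSn k))// leq_pmulr.
have cvs := cvg_comp _ _ sub cvb.
rewrite -(cvg_lim _ cvs)//; apply: lime_le.
  by apply/cvg_ex; eexists; exact: cvs.
near=> k => /=.
have := @b_fin_le _ alpha _ _ _ (achievable_mul k.+1 ach).
rewrite !natrM invfM mulrACA mulVf ?pnatr_eq0// mul1r; apply.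
by rewrite mulrCA -mulrA ler_pM2l ?ltr0n.
Unshelve. all: by end_near.
Qed.


(** * Resistances of a queen-bee network as diagonal Green values *)

Lemma queen_bee_network (R : realType) (G : rooted_graph) : queen_bee G ->
  exists (T : finType) (s : seq (option T * option T)) (g : T -> T -> R),
    [/\ #|T| = num_nonroot G, (#|T| + size s)%N = num_edges G,
        all (fun e => e.1 != e.2) s, forall x w, qform s (g x) w = w x &
        mean_res R G = (#|T|%:R^-1 * \sum_x g x x)%:E].
Proof.
move=> qb; pose rho := Defs.root G; pose T : finType := {x : vertex G | x != rho}.
pose vx (o : option T) : vertex G := oapp val rho o.
have vxK (x : vertex G) : vx (insub x) = x.
  by rewrite /vx; case: insubP => [u _ <-//|/negPn/eqP].
have vxI : cancel vx (insub : vertex G -> option T).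
  by move=> [x|]; rewrite /vx /= ?valK// insubF// eqxx.
have /boolp.choice[f fE] : forall e : edge G, exists p : option T * option T,
    p.1 != p.2 /\ ends e = [set vx p.1; vx p.2]%SET.
  move=> e; have /cards2P[x [y [xy ->]]] : #|ends e| == 2%N by rewrite card_ends.
  exists (insub x, insub y); rewrite /= !vxK; split=> //.
  by apply: contraNneq xy => /(congr1 vx); rewrite !vxK => ->.
(* The edges chosen by [c] become the sum of squares in [qform]; the remaining ones form [s]. *)
have /boolp.choice[c cE] : forall x : T, exists e, ends e = [set rho; val x]%SET.
  by move=> x; apply: qb (valP x).
have inj_c : injective c.
  move=> x y /(congr1 (@ends G)); rewrite !cE => E; apply/val_inj/eqP.
  have : val x \in [set rho; val y]%SET by rewrite -E !inE eqxx orbT.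
  by rewrite !inE (negbTE (valP x)).
pose C : {set edge G} := [set c x | x in T]%SET.
pose s := [seq f e | e <- enum [pred e | e \notin C]].
have cardCT : #|C| = #|T| by rewrite card_imset.
have energy (v phi : vertex G -> R) : \sum_e edge_form e v phi
    = qform s (fun x => v (val x) - v rho) (fun x => phi (val x) - phi rho).
  have potE (u : vertex G -> R) o :
      pot (fun x : T => u (val x) - u rho) o = u (vx o) - u rho.
    by case: o => //=; rewrite subrr.
  rewrite (bigID (mem C)) /= big_imset/=; last by move=> x y _ _; apply: inj_c.
  congr (_ + _); first apply: eq_bigr => x _.
    rewrite (edge_formE _ _ _ (cE x)); last by rewrite eq_sym (valP x).
    by ring.
  rewrite /dirichlet big_map big_enum /=; apply: eq_bigr => e _.
  have [ne ee] := fE e; rewrite !potE (edge_formE _ _ _ ee); first by ring.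
  by apply: contraNneq ne => /(can_inj vxI) ->.
have [g greenP] := green_exists R s.
exists T, s, g; split=> //.
- by rewrite card_sig.
- by rewrite size_map -cardE -cardCT cardC.
- by rewrite all_map; apply/allP => e _ /=; case: (fE e).
have Rx (x : T) : eff_res R rho (val x) = (g x x)%:E.
  rewrite /eff_res ifT; last first.
    by apply: connect1; apply/existsP; exists (c x); rewrite cE.
  (* The sign is negative because the current enters at the root and leaves at [x]. *)
  pose v y := - pot (g x) (insub y).
  have vrho : v rho = 0 by rewrite /v insubF ?eqxx//= oppr0.
  have Qv (phi : T -> R) : qform s (fun y => v (val y) - v rho) phi = - phi x.
    rewrite -(greenP x phi) -qform_oppl; congr qform.
    by apply/funext => y; rewrite vrho /v valK subr0.
  congr (_%:E); apply: xget_unique.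
    exists v; rewrite vrho /v valK /= opprK add0r; split=> //.
    by apply/unit_currentP => phi; rewrite energy Qv opprB.
  (* Uniqueness by reciprocity: the law for [v'] tested against [v], and the symmetry of the
     form. *)
  move=> _ [v' [/unit_currentP cur ->]].
  have := cur v; rewrite energy qformC Qv vrho /v valK /= opprK add0r => <-.
  by rewrite opprB.
rewrite /mean_res card_sig -/(num_nonroot G) EFinM -sumEFin; congr (_ * _)%E.
rewrite (bigD1 rho)//= eff_res_refl add0e.
rewrite (eq_bigl (mem [set val x | x in T]%SET)).
  rewrite big_imset /=; last by move=> x y _ _ /val_inj.
  by apply: eq_big => [x|x _]; [rewrite inE | exact: Rx].
move=> y /=; apply/idP/imsetP => [yr|[x _ ->]]; last exact: valP x.
by exists (Sub y yr).
Qed.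


(** * Comparison with the explicit networks and conclusion *)

(* The three bounds are the ones [charging_bound] gives for queen-bee networks
   with almost all resistances at least 1/2; [r] is the number of extra edges
   per vertex. *)
Lemma gadget_bound (R : realType) (alpha r c : R) (n l : nat) : (0 < n)%N ->
  alpha = 2 * (1 + r) -> l%:R = r * n%:R ->
  c <= r / 192 -> c <= 1 / 400 ->
  [\/ b_lim alpha <= (1 - 2 / 3 * r - c)%:E,
      b_lim alpha <= (5 / 6 - 3 / 8 * r - c)%:E |
      b_lim alpha <= (1 / 2 - c)%:E]%E.
Proof.
move=> n0 -> lE cr c1.
have n0R : 0 < n%:R :> R by rewrite ltr0n.
have crn : c * n%:R <= l%:R / 192 by nra.
have c1n : c * n%:R <= n%:R / 400 by nra.
have [h1|h1] := leqP (7 * l) (4 * n).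
  (* For [r <= 4/7], hubs mixed with leaves on [4 * n] vertices gain exactly [r / 192] per vertex
     over [1 - 2 / 3 * r]. *)
  apply: Or31.
  have ach := achievable_add (achievable_mul l (achievable_hubs R))
    (achievable_mul (4 * n - 7 * l) (achievable_leaf R)).
  apply: (b_lim_le _ ach); first by rewrite muln1 mulnC subnKC// muln_gt0.
    by rewrite !natrD !natrM natrB// !natrM; lra.
  by rewrite !natrD !natrM natrB// !natrM; lra.
have [h2|h2] := leqP (8 * l) (7 * n).
  (* For [r] between [4/7] and [7/8], hubs and paths are mixed on [17 * n] vertices; here, and for
     paths alone beyond [7/8], the gain exceeds [1/400]. *)
  apply: Or32.
  have ach := achievable_add (achievable_mul (7 * n - 8 * l) (achievable_hubs R))
    (achievable_mul (7 * l - 4 * n) (achievable_path R)).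
  have h1' := ltnW h1.
  have : (4 * n)%:R <= (7 * l)%:R :> R by rewrite ler_nat.
  have : (8 * l)%:R <= (7 * n)%:R :> R by rewrite ler_nat.
  rewrite !natrM => h1R h2R.
  have NE : (((7 * n - 8 * l) * 7 + (7 * l - 4 * n) * 8)%N)%:R = 17 * n%:R :> R.
    by rewrite natrD !natrM !natrB// !natrM; ring.
  apply: (b_lim_le _ ach); first by rewrite -(ltr0n R) NE mulr_gt0.
    by rewrite NE natrD !natrM !natrB// !natrM; lra.
  by rewrite NE !natrB// !natrM; lra.
apply: Or33; apply: (b_lim_le _ (achievable_mul n (achievable_path R))).
- by rewrite muln_gt0 n0.
- have : (7 * n)%:R <= (8 * l)%:R :> R by rewrite ler_nat ltnW.
  by rewrite !natrM; lra.
- by rewrite !natrM; lra.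
Qed.

Theorem theorem21 (R : realType) (alpha : R) (halpha : 2 < alpha) :
  exists delta : R, 0 < delta /\
    forall G : rooted_graph,
      (0 < num_nonroot G)%N ->
      queen_bee G ->
      average_degree R G = alpha ->
      (b_lim alpha + delta%:E <= mean_res R G)%E.
Proof.
pose r := alpha / 2 - 1; have r0 : 0 < r by rewrite /r; lra.
pose c := Num.min (r / 192) (1 / 400).
have c0 : 0 < c by rewrite lt_min; apply/andP; split; lra.
have [cr c1] : c <= r / 192 /\ c <= 1 / 400 by rewrite !ge_min !lexx orbT.
(* [kap] is the margin below [1/2] and [tau] the density of [X]: a total deficit above [c / 4] per
   vertex leaves [c / 8] after the margin, and dividing by [3/2] gives [c / 12]. The choice of [a]
   makes [a] times the degree bound [1 + 2 * r] equal to [tau]. *)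
pose kap := c / 8; pose tau := c / 12; pose a := tau / (1 + 2 * r).
have kap0 : 0 < kap by rewrite divr_gt0.
have tau0 : 0 < tau by rewrite divr_gt0.
have a0 : 0 < a by rewrite divr_gt0//; lra.
exists (Num.min (c / 2) (kap * tau * a ^+ 2 / 2)); split.
  have kta0 := mulr_gt0 (mulr_gt0 kap0 tau0) (exprn_gt0 2 a0).
  by rewrite lt_min !divr_gt0.
move=> G n0 qb dG.
have [T [s [g [nE mE loopless greenP ->]]]] := queen_bee_network R qb.
rewrite -nE in n0; have n0R : 0 < #|T|%:R :> R by rewrite ltr0n.
have aE : alpha = 2 * (1 + r) by rewrite /r; field.
have lE : (size s)%:R = r * #|T|%:R :> R.
  by move: dG; rewrite /average_degree -nE -mE /r natrD => <-;
    field; rewrite gt_eqF.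
set S := \sum_x g x x; set n := #|T| in n0 n0R lE *.
set delta := Num.min _ _.
have [d1 d2] : delta <= c / 2 /\ delta <= kap * tau * a ^+ 2 / 2.
  by rewrite !ge_min !lexx orbT.
have finish (q : R) : (b_lim alpha <= q%:E)%E -> (q + delta) * n%:R <= S ->
    (b_lim alpha + delta%:E <= (n%:R^-1 * S)%:E)%E.
  move=> bq qS; apply: le_trans (leeD2r _ bq) _.
  by rewrite -EFinD lee_fin mulrC ler_pdivlMr.
have dn : delta * n%:R <= c / 2 * n%:R by rewrite ler_pM2r.
pose P := \sum_x Num.max (1 / 2 - g x x) 0.
(* [P] is the total deficit below [1/2]. If it is small, the error [2 * P] uses up at most half of
   the gain [c], and [delta] fits into the rest. *)
have [Psmall|Pbig] := lerP P (c / 4 * n%:R).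
  have charge (lam mu : R) : 0 <= mu -> mu <= 1 / 2 -> 1 / 2 <= lam + mu ->
      1 / 3 <= lam / 2 + mu -> 5 / 4 <= 2 * lam + 3 * mu ->
      (1 - mu) * n%:R - S - 2 * P <= lam * (r * n%:R).
    move=> h0 h1 h2 h3 h4; rewrite -lE.
    have h01 : 0 <= mu <= 1 / 2 by rewrite h0 h1.
    apply: le_trans (charging_bound greenP loopless h01 h2 h3 h4).
    by rewrite sumrB sumrB sumr_const -mulr_sumr mulr_natr.
  have half : n%:R / 2 - P <= S.
    have -> : n%:R / 2 - P = \sum_x (1 / 2 - Num.max (1 / 2 - g x x) 0).
      by rewrite sumrB sumr_const; congr (_ - _); rewrite -[RHS]mulr_natl mul1r.
    apply: ler_sum => x _.
    by case: (lerP (1 / 2 - g x x) 0); lra.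
  have [bq|bq|bq] := gadget_bound n0 aE lE cr c1; apply: (finish _ bq).
  - by have := charge (2 / 3) 0 ltac:(lra) ltac:(lra) ltac:(lra) ltac:(lra)
      ltac:(lra); lra.
  - by have := charge (3 / 8) (1 / 6) ltac:(lra) ltac:(lra) ltac:(lra) ltac:(lra)
      ltac:(lra); lra.
  - by have := mulr_gt0 c0 n0R; lra.
pose th := 1 / 2 - kap.
have th0 : 0 < th by rewrite /th /kap; lra.
have [X [row_X sum_X]] := spread_set_exists greenP (ltW th0).
have Xbig : tau * n%:R <= #|X|%:R.
  have : P - kap * n%:R <= \sum_x Num.max (th - g x x) 0.
    have -> : P - kap * n%:R = \sum_x (Num.max (1 / 2 - g x x) 0 - kap).
      by rewrite sumrB sumr_const mulr_natr.
    apply: ler_sum => x _.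
    rewrite /th; case: (lerP (1 / 2 - g x x) 0) => ?;
      by case: (lerP (1 / 2 - kap - g x x) 0); lra.
  have : (1 + th) * #|X|%:R <= (3 / 2) * #|X|%:R :> R.
    by rewrite ler_wpM2r// /th; lra.
  by rewrite /tau /kap in Pbig *; lra.
have coer w : th^-1 * \sum_(x in X) w x ^+ 2 <= qform s w w.
  by apply: (spread_set_coercive greenP); rewrite ?invr_gt0 ?invrK.
have k1 : 1 <= th^-1 by rewrite invf_ge1// /th; lra.
have ach := achievable_rewire greenP loopless k1 coer.
set W := \sum_(x in X) \sum_z g x z ^+ 2 in ach.
have Wbig : tau * a ^+ 2 * n%:R <= W.
  (* Combine [g^2 >= 2 a g - a^2] with [green_diag_lb]. *)
  have : \sum_(x in X) (3 * a ^+ 2 - 2 * a ^+ 3 * (1 + (extra_degree s x)%:R)) <= W.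
    apply: ler_sum => x _; apply: (@le_trans _ _ (g x x ^+ 2)).
      have := green_diag_lb greenP loopless x a.
      by have := sqr_ge0 (g x x - a); nra.
    by rewrite [leRHS](bigD1 x)//= lerDl sumr_ge0// => z _; rewrite sqr_ge0.
  rewrite sumrB sumr_const -mulr_sumr => WX.
  have degX : \sum_(x in X) (1 + (extra_degree s x)%:R) <= (1 + 2 * r) * n%:R.
    have -> : (1 + 2 * r) * n%:R = n%:R + 2 * (size s)%:R by rewrite lE; ring.
    apply: le_trans (sum_degree_le _ s).
    by rewrite [leRHS](bigID (mem X)) /= lerDl sumr_ge0.
  have tauE : tau = a * (1 + 2 * r) by rewrite /a divfK// gt_eqF//; lra.
  have : 2 * a ^+ 3 * \sum_(x in X) (1 + (extra_degree s x)%:R)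
      <= 2 * a ^+ 3 * ((1 + 2 * r) * n%:R).
    by rewrite ler_wpM2l// mulr_ge0 ?exprn_ge0 ?ltW.
  have : 3 * a ^+ 2 * (tau * n%:R) <= 3 * a ^+ 2 * #|X|%:R.
    by rewrite ler_wpM2l// mulr_ge0 ?exprn_ge0 ?ltW.
  have -> : 2 * a ^+ 3 * ((1 + 2 * r) * n%:R) = 2 * a ^+ 2 * (tau * n%:R).
    by rewrite tauE; ring.
  by move: WX; rewrite -mulr_natr; lra.
have gain : kap <= (th^-1 ^+ 2 - 2 * th^-1) / (th^-1 ^+ 2 + th^-1 - 1).
  have th1 : th <= 1 / 2 by rewrite /th; lra.
  have D0 : 0 < 1 + th - th ^+ 2 by nra.
  (* The numerator on the right is [2 * kap] and the denominator is at most 2. *)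
  have -> : (th^-1 ^+ 2 - 2 * th^-1) / (th^-1 ^+ 2 + th^-1 - 1)
      = (1 - 2 * th) / (1 + th - th ^+ 2).
    by field; rewrite !gt_eqF.
  rewrite ler_pdivlMr// [leRHS](_ : _ = kap * 2); last by rewrite /th; field.
  by rewrite ler_pM2l//; nra.
apply: (@finish ((2 * S - kap * W) / (2 * n%:R))).
  apply: (b_lim_le _ ach); first by rewrite muln_gt0.
    by rewrite aE !natrM natrD lE; lra.
  rewrite natrM divfK ?mulf_neq0 ?gt_eqF//.
  rewrite lerD2l lerN2 ler_wpM2r//.
  by apply: sumr_ge0 => x _; apply: sumr_ge0 => z _; rewrite sqr_ge0.
have -> : ((2 * S - kap * W) / (2 * n%:R) + delta) * n%:R
    = S - kap * W / 2 + delta * n%:R by field; rewrite gt_eqF.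
have : delta * n%:R <= kap * tau * a ^+ 2 / 2 * n%:R by rewrite ler_pM2r.
have : kap * (tau * a ^+ 2 * n%:R) <= kap * W by rewrite ler_pM2l.
lra.
Qed.
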